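(* There is an absolute constant $c>0$ such that for all $n\ge3$ the following holds. Let $X_1,\dots,X_m$ be nonzero real symmetric positive semidefinite $n\times n$ matrices with $\sum_{i=1}^mX_i=I$. Then there exists $S\subseteq[m]$ with $|S|\le n$ such that $\sum_{i\in S}X_i/\operatorname{tr}X_i$ has full rank $n$ and maximum eigenvalue at most $c\log n/\log\log n$. *)

(* Defs.v *)
(* MathComp matrices over the Stdlib real numbers R.
   We equip Stdlib's R with the MathComp structures (eqType, choiceType,
   field, realFieldType) so that MathComp's linear algebra (\rank, \tr,
   eigenvalue) can be used, while log is Stdlib's [ln]. *)
From HB Require Import structures.
From Stdlib Require Import Reals Lra.
From Stdlib Require Import ClassicalEpsilon FunctionalExtensionality.
From mathcomp Require Import all_boot all_order all_algebra.

Set Implicit Arguments.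
Unset Strict Implicit.
Unset Printing Implicit Defensive.

Import Order.TTheory GRing.Theory Num.Theory.

Definition R_eqb (x y : R) : bool := if Req_EM_T x y then true else false.

Lemma R_eqP : Equality.axiom R_eqb.
Proof. move=> x y; rewrite /R_eqb; case: Req_EM_T => h; constructor => //. Qed.

HB.instance Definition _ := hasDecEq.Build R R_eqP.

Definition R_find (P : pred R) (n : nat) : option R :=
  match excluded_middle_informative (exists x, P x) with
  | left h => Some (proj1_sig (constructive_indefinite_description _ h))
  | right _ => None
  end.

Lemma R_find_correct P n x : R_find P n = Some x -> P x.
Proof.
rewrite /R_find; case: excluded_middle_informative => // h [<-].
exact: proj2_sig (constructive_indefinite_description _ h).
Qed.

Lemma R_find_complete (P : pred R) : (exists x, P x) -> exists n, R_find P n.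
Proof. move=> h; exists 0%N; rewrite /R_find; case: excluded_middle_informative => //. Qed.

Lemma R_find_ext (P Q : pred R) : P =1 Q -> R_find P =1 R_find Q.
Proof.
move=> hPQ; have -> : P = Q by apply: functional_extensionality.
by [].
Qed.

HB.instance Definition _ :=
  hasChoice.Build R R_find_correct R_find_complete R_find_ext.

Lemma R_addA : associative Rplus. Proof. by move=> *; rewrite Rplus_assoc. Qed.
Lemma R_addC : commutative Rplus. Proof. exact: Rplus_comm. Qed.
Lemma R_add0 : left_id R0 Rplus. Proof. exact: Rplus_0_l. Qed.
Lemma R_addN : left_inverse R0 Ropp Rplus. Proof. exact: Rplus_opp_l. Qed.

HB.instance Definition _ := GRing.isZmodule.Build R R_addA R_addC R_add0 R_addN.

Lemma R_mulA : associative Rmult. Proof. by move=> *; rewrite Rmult_assoc. Qed.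
Lemma R_mulC : commutative Rmult. Proof. exact: Rmult_comm. Qed.
Lemma R_mul1 : left_id R1 Rmult. Proof. exact: Rmult_1_l. Qed.
Lemma R_mulDl : left_distributive Rmult Rplus.
Proof. by move=> x y z; rewrite Rmult_plus_distr_r. Qed.
Lemma R_one_neq0 : R1 != R0.
Proof. by apply/eqP; exact: R1_neq_R0. Qed.

HB.instance Definition _ :=
  GRing.Zmodule_isComNzRing.Build R R_mulA R_mulC R_mul1 R_mulDl R_one_neq0.

Definition R_inv (x : R) : R := if x == R0 then R0 else Rinv x.

Lemma R_mulVf (x : R) : x != R0 -> Rmult (R_inv x) x = R1.
Proof.
move=> /eqP hx; rewrite /R_inv; case: eqP => // _.
exact: Rinv_l.
Qed.

Lemma R_inv0 : R_inv R0 = R0.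
Proof. by rewrite /R_inv eqxx. Qed.

HB.instance Definition _ := GRing.ComNzRing_isField.Build R R_mulVf R_inv0.

Definition R_leb (x y : R) : bool := if Rle_dec x y then true else false.
Definition R_ltb (x y : R) : bool := if Rlt_dec x y then true else false.

Lemma R_lebP x y : reflect (Rle x y) (R_leb x y).
Proof. rewrite /R_leb; case: Rle_dec => h; constructor => //. Qed.
Lemma R_ltbP x y : reflect (Rlt x y) (R_ltb x y).
Proof. rewrite /R_ltb; case: Rlt_dec => h; constructor => //. Qed.

Lemma R_le0_add (x y : R) : R_leb R0 x -> R_leb R0 y -> R_leb R0 (Rplus x y).
Proof.
move=> /R_lebP hx /R_lebP hy; apply/R_lebP.
change (Rle R0 (Rplus x y)); lra.
Qed.

Lemma R_le0_mul (x y : R) : R_leb R0 x -> R_leb R0 y -> R_leb R0 (Rmult x y).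
Proof.
move=> /R_lebP hx /R_lebP hy; apply/R_lebP.
change (Rle R0 (Rmult x y)); exact: Rmult_le_pos.
Qed.

Lemma R_le0_anti (x : R) : R_leb R0 x -> R_leb x R0 -> x = R0.
Proof. move=> /R_lebP h1 /R_lebP h2; change (x = R0); lra. Qed.

Lemma R_sub_ge0 (x y : R) : R_leb R0 (Rplus y (Ropp x)) = R_leb x y.
Proof.
apply/idP/idP => /R_lebP h; apply/R_lebP; lra.
Qed.

Lemma R_le0_total (x : R) : R_leb R0 x || R_leb x R0.
Proof.
case: (Rle_dec R0 x) => h; first by apply/orP; left; apply/R_lebP.
by apply/orP; right; apply/R_lebP; change (Rle x R0); lra.
Qed.

Lemma R_normN (x : R) : Rabs (Ropp x) = Rabs x.
Proof. exact: Rabs_Ropp. Qed.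

Lemma R_ge0_norm (x : R) : R_leb R0 x -> Rabs x = x.
Proof. move=> /R_lebP h; exact: Rabs_right (Rle_ge _ _ h). Qed.

Lemma R_lt_def (x y : R) : R_ltb x y = (y != x) && R_leb x y.
Proof.
apply/R_ltbP/andP => [h|[/eqP h1 /R_lebP h2]].
  split; [apply/eqP => e; rewrite e in h; lra | apply/R_lebP; lra].
by case: (Rle_lt_or_eq_dec _ _ h2) => // e; case: h1.
Qed.

HB.instance Definition _ :=
  Num.IntegralDomain_isLeReal.Build R R_le0_add R_le0_mul R_le0_anti
    R_sub_ge0 R_le0_total R_normN R_ge0_norm R_lt_def.

Local Open Scope ring_scope.

Definition psd (n : nat) (A : 'M[R]_n) : Prop :=
  A^T = A /\ forall v : 'rV[R]_n, 0 <= (v *m A *m v^T) 0 0.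

(* Main.v *)
(** Potential-function rounding.  Write [X_i = W_i^T W_i] and let [v_t] range over the
rows of all the [W_i], so that [sum_t v_t^T v_t = I].  By the multilinear expansion
of determinants, the weights [det (v_f1, ..., v_fn)^2 / n!] make the vector
[x_t = |v_t|^2] a convex combination of indicators of bases of [R^n] among the [v_t].
With [A_t = X_i / tr X_i] for [t] in block [i], consider
[F x = tr (q + sum_t phi (x_t) A_t)^(q+1)], [phi y = ln (1 + 2 g y) / 2].
Since [phi'' = - 2 phi'^2], [(u - w)^2 <= 2 u^2 + 2 w^2] and [A_t^2 <= A_t], [F] is
concave along every exchange direction [e_b - e_a]; merging the bases two at a time
by symmetric exchanges therefore yields a single basis [B] with
[F 1_B <= F x <= n (q + g)^(q+1)].  An eigenvalue [a] then satisfies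
[(q + phi 1 * a)^(q+1) <= n (q + g)^(q+1)], and the choices [1 + 2 g = ln n] and
[3^q <= n < 3^(q+1)] give the bound with [c = 9]. *)

Require Import Defs.
From HB Require Import structures.
From Stdlib Require Import Reals FunctionalExtensionality.
From mathcomp Require Import all_boot all_order all_algebra perm ring lra.
Import Order.TTheory GRing.Theory Num.Theory.

Set Implicit Arguments.
Unset Strict Implicit.
Unset Printing Implicit Defensive.

Local Open Scope ring_scope.

(* Stdlib binds [R_scope] to [R]; without the following, [+] and [*] in arguments and
   bodies of type [R] would denote [Rplus] and [Rmult] instead of the ring operations. *)
#[local] Bind Scope ring_scope with R.
#[local] Arguments ln _%_ring_scope.
#[local] Arguments derivable_pt_lim _%_function_scope (_ _)%_ring_scope.

(** * Positive semidefinite matrices *)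

Definition bform (n : nat) (A : 'M[R]_n) (u v : 'rV[R]_n) : R :=
  (u *m A *m v^T) 0 0.

Lemma bformDl n (A : 'M[R]_n) u u' v :
  bform A (u + u') v = bform A u v + bform A u' v.
Proof. by rewrite /bform !mulmxDl mxE. Qed.

Lemma bformDr n (A : 'M[R]_n) u v v' :
  bform A u (v + v') = bform A u v + bform A u v'.
Proof. by rewrite /bform linearD mulmxDr mxE. Qed.

Lemma bformZl n (A : 'M[R]_n) c u v : bform A (c *: u) v = c * bform A u v.
Proof. by rewrite /bform -!scalemxAl mxE. Qed.

Lemma bformZr n (A : 'M[R]_n) c u v : bform A u (c *: v) = c * bform A u v.
Proof. by rewrite /bform linearZ /= -scalemxAr mxE. Qed.

Lemma bformDm n (A B : 'M[R]_n) u v :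
  bform (A + B) u v = bform A u v + bform B u v.
Proof. by rewrite /bform mulmxDr mulmxDl mxE. Qed.

Lemma bformZm n (A : 'M[R]_n) c u v : bform (c *: A) u v = c * bform A u v.
Proof. by rewrite /bform -scalemxAr -scalemxAl mxE. Qed.

Lemma trmx11E (A : 'M[R]_1) : A 0 0 = A^T 0 0.
Proof. by rewrite mxE. Qed.

Lemma bform_tr n (A : 'M[R]_n) u v : bform A^T u v = bform A v u.
Proof.
by rewrite /bform trmx11E !trmx_mul !trmxK mulmxA.
Qed.

Lemma bform_sym n (A : 'M[R]_n) u v : A^T = A -> bform A u v = bform A v u.
Proof. by move=> sA; rewrite -bform_tr sA. Qed.

Lemma psd_bform n (A : 'M[R]_n) v : psd A -> 0 <= bform A v v.
Proof. by case=> _; apply. Qed.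

Lemma psd_sym n (A : 'M[R]_n) : psd A -> A^T = A.
Proof. by case. Qed.

(** With a, b, c the values of the form at (u, u), (u, v), (v, v), positivity at [c u - b v] reads
    [c (a c - b^2) >= 0], and c may be divided out when it is positive; symmetrically for a. *)
Lemma psd_cauchy_schwarz n (A : 'M[R]_n) u v :
  psd A -> bform A u v ^+ 2 <= bform A u u * bform A v v.
Proof.
move=> pA.
have key x y : 0 <= bform A y y * (bform A x x * bform A y y - bform A x y ^+ 2).
  have := psd_bform (bform A y y *: x + (- bform A x y) *: y) pA.
  rewrite !bformDl !bformDr !bformZl !bformZr (bform_sym y x) ?psd_sym//.
  set a := bform A x x; set b := bform A x y; set c := bform A y y.
  suff -> : c * (c * a) + c * (- b * b) + (- b * (c * b) + - b * (- b * c))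
      = c * (a * c - b ^+ 2) by [].
  by ring.
have := key u v; have := key v u; rewrite (bform_sym v u) ?psd_sym//.
have := psd_bform (u + v) pA; have := psd_bform (u + (-1) *: v) pA.
have := psd_bform u pA; have := psd_bform v pA.
rewrite !bformDl !bformDr !bformZl !bformZr (bform_sym v u) ?psd_sym//.
set a := bform A u u; set b := bform A u v; set c := bform A v v.
move=> c0 a0 h1 h2 h3 h4.
have [c1|c1] := ltrP 0 c; first by move: h4; rewrite pmulr_rge0// subr_ge0.
have [a1|a1] := ltrP 0 a; first by move: h3; rewrite pmulr_rge0// subr_ge0 mulrC.
(* Here a = c = 0, so positivity at [u + v] and at [u - v] gives both signs of b. *)
have -> : b = 0 by lra.
by rewrite expr0n mulr_ge0.
Qed.

Lemma psd0 n : psd (0 : 'M[R]_n).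
Proof. by split=> [|v]; rewrite ?trmx0// mulmx0 mul0mx mxE. Qed.

Lemma psdD n (A B : 'M[R]_n) : psd A -> psd B -> psd (A + B).
Proof.
move=> [sA pA] [sB pB]; split=> [|v]; first by rewrite linearD /= sA sB.
by rewrite mulmxDr mulmxDl mxE addr_ge0.
Qed.

Lemma psdZ n (A : 'M[R]_n) c : 0 <= c -> psd A -> psd (c *: A).
Proof.
move=> c0 [sA pA]; split=> [|v]; first by rewrite linearZ /= sA.
by rewrite -scalemxAr -scalemxAl mxE mulr_ge0.
Qed.

Lemma psd_sum n (I : Type) (r : seq I) (P : pred I) (F : I -> 'M[R]_n) :
  (forall i, P i -> psd (F i)) -> psd (\sum_(i <- r | P i) F i).
Proof.
by move=> h; elim/big_rec: _ => [|i x Pi px]; [exact: psd0|apply: psdD => //; exact: h].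
Qed.

Lemma psd_congr m n (A : 'M[R]_n) (B : 'M[R]_(m, n)) : psd A -> psd (B *m A *m B^T).
Proof.
move=> [sA pA]; split=> [|v]; first by rewrite !trmx_mul trmxK sA mulmxA.
by have := pA (v *m B); rewrite trmx_mul !mulmxA.
Qed.

Lemma psd1 n : psd (1%:M : 'M[R]_n).
Proof.
split=> [|v]; first exact: trmx1.
by rewrite mulmx1 mxE sumr_ge0// => i _; rewrite mxE -expr2 sqr_ge0.
Qed.

Lemma psd_gram m n (W : 'M[R]_(m, n)) : psd (W^T *m W).
Proof. by have := psd_congr W^T (psd1 m); rewrite mulmx1 trmxK. Qed.

Lemma psd_sqr n (D : 'M[R]_n) : D^T = D -> psd (D *m D).
Proof. by move=> sD; have := psd_gram D; rewrite sD. Qed.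

Lemma psd_scalar n c : 0 <= c -> psd (c%:M : 'M[R]_n).
Proof. by move=> c0; rewrite -scalemx1; apply: psdZ => //; exact: psd1. Qed.

Lemma trmxX n (A : 'M[R]_n) k : (A ^+ k)^T = A^T ^+ k.
Proof.
elim: k => [|k IH]; first by rewrite !expr0 trmx1.
by rewrite exprS exprSr -!mulmxE trmx_mul IH.
Qed.

(** An even power is a congruence of the identity and an odd one a congruence of [M], both by the
    power k/2. *)
Lemma psdX n (M : 'M[R]_n) k : psd M -> psd (M ^+ k).
Proof.
move=> pM; have -> : M ^+ k = M ^+ k./2 *m M ^+ odd k *m (M ^+ k./2)^T.
  rewrite trmxX psd_sym// !mulmxE -!exprD; congr (_ ^+ _).
  by rewrite addnAC addnn addnC odd_double_half.
by apply: psd_congr; case: (odd k); rewrite ?expr1// expr0; exact: psd1.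
Qed.

Lemma psd_diag_ge0 n (A : 'M[R]_n) i : psd A -> 0 <= A i i.
Proof.
move=> pA; have := psd_bform (delta_mx 0 i) pA.
by rewrite /bform -rowE trmx_delta -colE !mxE.
Qed.

(* Cholesky elimination: each step subtracts a rank one matrix that clears one more row. *)
Lemma psd_gramP n (X : 'M[R]_n) : psd X -> exists W : 'M[R]_n, X = W^T *m W.
Proof.
move=> pX.
suff [u hu] : exists u : 'I_n -> 'rV[R]_n, X = \sum_k (u k)^T *m u k.
  exists (\matrix_k u k); rewrite hu; apply/matrixP => i j.
  rewrite summxE mxE; apply: eq_bigr => k _.
  by rewrite !mxE big_ord1 !mxE.
suff [u [pu ru]] : exists u : 'I_n -> 'rV[R]_n,
    psd (X - \sum_(k <- enum 'I_n) (u k)^T *m u k) /\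
    forall i, i \in enum 'I_n -> row i (X - \sum_(k <- enum 'I_n) (u k)^T *m u k) = 0.
  exists u; apply/eqP; rewrite -subr_eq0; apply/eqP/row_matrixP => i.
  by rewrite row0 -[RHS](ru i) ?mem_enum// big_enum.
elim: (enum 'I_n) (enum_uniq 'I_n) => [_|k s IH /= /andP[ks us]].
  by exists (fun=> 0); split=> //; rewrite big_nil subr0.
have {IH us} [u [pZ rZ]] := IH us.
move: pZ rZ; set Z := X - _ => pZ rZ.
have ZE : Z = X - \sum_(j <- s) (u j)^T *m u j by [].
clearbody Z.
have sZ := psd_sym pZ.
have Zkk := psd_diag_ge0 k pZ.
(* If the pivot [Z k k] vanishes, the convention 0^-1 = 0 makes [w] zero; row k of [Z] is then
   already zero by Cauchy-Schwarz. *)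
pose w := (sqrt (Z k k))^-1 *: row k Z.
have bfE v : bform Z v (delta_mx 0 k) = (v *m (row k Z)^T) 0 0.
  by rewrite /bform -mulmxA trmx_delta -colE tr_row sZ.
have bkk : bform Z (delta_mx 0 k) (delta_mx 0 k) = Z k k.
  by rewrite bfE -rowE !mxE.
have sq : sqrt (Z k k) * sqrt (Z k k) = Z k k.
  by apply: sqrt_sqrt; exact/R_lebP.
exists (fun j => if j == k then w else u j).
rewrite big_cons eqxx.
have -> : \sum_(j <- s) (if j == k then w else u j)^T *m (if j == k then w else u j)
   = \sum_(j <- s) (u j)^T *m u j.
  rewrite big_seq [RHS]big_seq; apply: eq_bigr => j js.
  by case: eqP => // jk; rewrite -jk js in ks.
have -> : X - (w^T *m w + \sum_(j <- s) (u j)^T *m u j) = Z - w^T *m w.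
  by rewrite ZE opprD addrA addrAC.
have ww : w^T *m w = (Z k k)^-1 *: ((row k Z)^T *m row k Z).
  by rewrite /w -scalemxAr [(_ *: _)^T]linearZ /= -scalemxAl scalerA -invfM sq.
have wv v : bform (w^T *m w) v v = (Z k k)^-1 * bform Z v (delta_mx 0 k) ^+ 2.
  rewrite ww bformZm bfE; congr (_ * _).
  rewrite /bform mulmxA -mulmxA mxE big_ord1 expr2; congr (_ * _).
  by rewrite trmx11E trmx_mul trmxK.
split.
  split; first by rewrite linearB /= trmx_mul trmxK sZ.
  move=> v; rewrite -[X in 0 <= X]/(bform _ v v) bformDm -scaleN1r bformZm wv.
  have := psd_cauchy_schwarz v (delta_mx 0 k) pZ; rewrite bkk => cs.
  have [z0|z0] := eqVneq (Z k k) 0.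
    by rewrite z0 invr0 mul0r mulr0 addr0 psd_bform.
  have zp : 0 < Z k k by rewrite lt_def z0.
  by rewrite mulN1r subr_ge0 mulrC ler_pdivrMr.
have row0P i : row i Z = 0 -> row i (Z - w^T *m w) = 0.
  move=> r0; rewrite linearB /= r0 sub0r row_mul.
  have -> : row i w^T = 0; last by rewrite mul0mx oppr0.
  apply/rowP => j; rewrite /w !mxE.
  have -> : Z k i = 0; last by rewrite mulr0.
  by rewrite -[Z]sZ mxE; have /rowP/(_ k) := r0; rewrite !mxE.
move=> i; rewrite inE => /orP[/eqP->|/rZ]; last exact: row0P.
have [z0|z0] := eqVneq (Z k k) 0.
  apply: row0P; apply/rowP => j.
  have := psd_cauchy_schwarz (delta_mx 0 j) (delta_mx 0 k) pZ.
  rewrite bkk z0 mulr0 bfE -rowE !mxE => h.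
  have /eqP : Z k j ^+ 2 = 0 by apply/eqP; rewrite eq_le h sqr_ge0.
  by rewrite expf_eq0 /= => /eqP.
rewrite linearB /= ww linearZ /= row_mul.
have -> : row k (row k Z)^T = (Z k k)%:M.
  by apply/matrixP => a b; rewrite !ord1 !mxE eqxx.
by rewrite mul_scalar_mx scalerA mulVf// scale1r subrr.
Qed.

Lemma trace_mul_gram m n (A : 'M[R]_n) (W : 'M[R]_(m, n)) :
  \tr (A *m (W^T *m W)) = \sum_i bform A (row i W) (row i W).
Proof.
rewrite mulmxA mxtrace_mulC mulmxA; apply: eq_bigr => i _.
by rewrite /bform -row_mul tr_row mxE [RHS]mxE; apply: eq_bigr => j _; rewrite !mxE.
Qed.

Lemma psd_trace_mul n (A B : 'M[R]_n) : psd A -> psd B -> 0 <= \tr (A *m B).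
Proof.
move=> pA /psd_gramP[W ->]; rewrite trace_mul_gram.
by apply: sumr_ge0 => i _; exact: psd_bform.
Qed.

(** By Cauchy-Schwarz [|v|^2 - v^T v] is psd, so its trace pairing with [A] is nonnegative. This
    bounds [A] by its trace without diagonalization. *)
Lemma bform_le_trace n (A : 'M[R]_n) v :
  psd A -> bform A v v <= \tr A * bform 1%:M v v.
Proof.
move=> pA.
have b1 : \sum_(i < 1) bform A (row i v) (row i v) = bform A v v.
  by rewrite big_ord1; have -> : row 0 v = v by apply/rowP => j; rewrite mxE.
have pN : psd (bform 1%:M v v *: 1%:M - v^T *m v).
  split; first by rewrite linearB /= linearZ /= trmx1 trmx_mul trmxK.
  move=> w; rewrite -[X in 0 <= X]/(bform _ w w) bformDm -scaleN1r !bformZm.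
  rewrite mulN1r subr_ge0; apply: le_trans (psd_cauchy_schwarz v w (psd1 n)).
  rewrite /bform !mulmx1 mulmxA -mulmxA mxE big_ord1 expr2.
  by rewrite [X in X * _]trmx11E trmx_mul trmxK.
have := psd_trace_mul pA pN.
rewrite mulmxDr -scalemxAr mulmx1 mulmxN linearB /= linearZ /= trace_mul_gram b1.
by rewrite subr_ge0 mulrC.
Qed.

Lemma psd_scalar_sub n (A : 'M[R]_n) : psd A -> psd ((\tr A)%:M - A).
Proof.
move=> pA; split; first by rewrite linearB /= tr_scalar_mx psd_sym.
move=> v; rewrite -[X in 0 <= X]/(bform _ v v) bformDm -scaleN1r -scalemx1 !bformZm.
by rewrite mulN1r subr_ge0 bform_le_trace.
Qed.

(** A nonpositive trace kills the quadratic form by [bform_le_trace], and Cauchy-Schwarz then kills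
    every entry. *)
Lemma psd_trace_gt0 n (A : 'M[R]_n) : psd A -> A != 0 -> 0 < \tr A.
Proof.
move=> pA; apply: contraNT; rewrite -leNgt => t0.
have z v : bform A v v = 0.
  apply/eqP; rewrite eq_le psd_bform// andbT.
  apply: le_trans (bform_le_trace v pA) _.
  by rewrite mulr_le0_ge0// psd_bform//; exact: psd1.
apply/eqP/matrixP => i j.
have := psd_cauchy_schwarz (delta_mx 0 i) (delta_mx 0 j) pA.
rewrite z mul0r /bform -rowE trmx_delta -colE !mxE => h.
have /eqP : A i j ^+ 2 = 0 by apply/eqP; rewrite eq_le h sqr_ge0.
by rewrite expf_eq0 /= => /eqP.
Qed.

(* [A (c - A) = (A (c - A) A + (c - A) A (c - A)) / c], a sum of congruences. *)
Lemma psd_mul_scalar_sub n (A : 'M[R]_n) c :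
  0 < c -> psd A -> psd (c%:M - A) -> psd (A *m (c%:M - A)).
Proof.
move=> c0 pA pB; set B := c%:M - A.
have AB : A *m B = B *m A.
  by rewrite /B mulmxBr mulmxBl mul_mx_scalar mul_scalar_mx.
have -> : A *m B = c^-1 *: (A *m B *m A^T + B *m A *m B^T).
  have ABc : A + B = c%:M by rewrite addrC subrK.
  rewrite !psd_sym// -AB -mulmxDr ABc mul_mx_scalar scalerA.
  by rewrite mulVf ?gt_eqF// scale1r.
by apply: psdZ; rewrite ?invr_ge0 ?ltW//; apply: psdD; exact: psd_congr.
Qed.

(** * Traces of matrix powers along a curve *)

Lemma RleP (x y : R) : reflect (Rle x y) (x <= y).
Proof. exact: R_lebP. Qed.

Lemma RltP (x y : R) : reflect (Rlt x y) (x < y).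
Proof. exact: R_ltbP. Qed.

Lemma ord_pred_subS k (i : 'I_k) : (k.-1 - i).+1 = (k - i)%N.
Proof. by case: k i => [[]//|k] i; rewrite /= subSn// -ltnS. Qed.

(** Noncommutative telescoping: it reduces commutators with powers to the single commutator of [M]
    and [D], with powers of [M] around it. *)
Lemma commutator_expand n (M D : 'M[R]_n) k :
  M ^+ k * D - D * M ^+ k =
  \sum_(i < k) M ^+ i * (M * D - D * M) * M ^+ (k.-1 - i).
Proof.
elim: k => [|k IH]; first by rewrite big_ord0 expr0 mul1r mulr1 subrr.
rewrite big_ord_recr /= subnn expr0 mulr1.
have -> : M ^+ k.+1 * D - D * M ^+ k.+1
    = (M ^+ k * D - D * M ^+ k) * M + M ^+ k * (M * D - D * M).
  by rewrite mulrBl mulrBr exprSr !mulrA [RHS]addrC addrA subrK.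
congr (_ + _); rewrite IH mulr_suml; apply: eq_bigr => i _.
rewrite -mulrA -exprSr; congr (_ * _ ^+ _).
exact: ord_pred_subS.
Qed.

(* In an eigenbasis of [M] the gap is a sum of
   [D_ab ^ 2 * (x_a ^ j - x_b ^ j) * (x_a ^ k - x_b ^ k) >= 0]. *)
Lemma trace_powers_le n (M D : 'M[R]_n) j k : psd M -> D^T = D ->
  \tr (M ^+ j * D * M ^+ k * D) <= \tr (M ^+ (j + k) * (D * D)).
Proof.
move=> pM sD; have sM := psd_sym pM.
pose X i := M ^+ i * D - D * M ^+ i.
have XT i : (X i)^T = D * M ^+ i - M ^+ i * D.
  by rewrite /X linearB /= -!mulmxE !trmx_mul trmxX sM sD.
have pos : 0 <= \tr (X j * (X k)^T).
  rewrite /X !commutator_expand linear_sum /= mulr_suml linear_sum /=.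
  apply: sumr_ge0 => a _; rewrite mulr_sumr linear_sum /=; apply: sumr_ge0 => b _.
  (* Cyclicity turns each term into the trace pairing of a power of [M] with a congruence by [C] of
     another power of [M]. *)
  set C := M * D - D * M.
  have -> : \tr (M ^+ a * C * M ^+ (j.-1 - a) * (M ^+ b * C * M ^+ (k.-1 - b))^T)
      = \tr (M ^+ (b + a) *m (C *m M ^+ (j.-1 - a + (k.-1 - b)) *m C^T)).
    rewrite -!mulmxE !trmx_mul !trmxX sM !mulmxA mxtrace_mulC !mulmxE !exprD.
    by rewrite !mulrA.
  by apply: psd_trace_mul; [exact: psdX|apply: psd_congr; exact: psdX].
have XX : \tr (X j * (X k)^T) =
    \tr (M ^+ (j + k) * (D * D)) *+ 2 - \tr (M ^+ j * D * M ^+ k * D) *+ 2.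
  rewrite XT /X mulrBl !mulrBr !linearB /=.
  have -> : \tr (M ^+ j * D * (D * M ^+ k)) = \tr (M ^+ (j + k) * (D * D)).
    by rewrite mulrA -mulmxE mxtrace_mulC mulmxE !mulrA -exprD addnC.
  have -> : \tr (D * M ^+ j * (D * M ^+ k)) = \tr (M ^+ j * D * M ^+ k * D).
    by rewrite -!mulrA -mulmxE mxtrace_mulC mulmxE !mulrA.
  have -> : \tr (D * M ^+ j * (M ^+ k * D)) = \tr (M ^+ (j + k) * (D * D)).
    by rewrite -!mulrA -mulmxE mxtrace_mulC mulmxE !mulrA -exprD.
  have -> : \tr (M ^+ j * D * (M ^+ k * D)) = \tr (M ^+ j * D * M ^+ k * D).
    by rewrite !mulrA.
  by rewrite !mulr2n; ring.
by move: pos; rewrite XX !mulr2n; lra.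
Qed.

(** Writing one factor [M] as [(M - c) + c] lowers k and leaves a nonnegative combination. *)
Lemma psd_mul_pow_shift n (M : 'M[R]_n) c j k : 0 <= c -> psd (M - c%:M) ->
  psd ((M - c%:M) ^+ j * M ^+ k).
Proof.
move=> c0 pN; elim: k j => [|k IH] j; first by rewrite expr0 mulr1; exact: psdX.
have -> : (M - c%:M) ^+ j * M ^+ k.+1 =
    (M - c%:M) ^+ j.+1 * M ^+ k + c *: ((M - c%:M) ^+ j * M ^+ k).
  rewrite exprS exprSr -!mulmxE scalemxAr -!mulmxA -mulmxDr; congr (_ *m _).
  by rewrite mulmxBl mul_scalar_mx subrK.
by apply: psdD => //; exact: psdZ.
Qed.

(** Up to the factor q + 1 this is the second derivative of [tr M^(q+1)] along a curve with first
    and second derivatives [D] and [E]. The sum is at most [q tr (M^(q-1) D^2)], hence at most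
    [tr (M^q D^2)] because [M >= q], and [E <= - D^2] cancels it. *)
Lemma trace_power_hessian_le0 n q (M D E : 'M[R]_n) :
  psd (M - q%:R%:M) -> D^T = D -> psd (- (E + D * D)) ->
  \sum_(j < q) \tr (M ^+ j * D * M ^+ (q.-1 - j) * D) + \tr (M ^+ q * E) <= 0.
Proof.
move=> pN sD pE.
have pM : psd M.
  rewrite -[M](subrK (q%:R%:M)); apply: psdD => //.
  by apply: psd_scalar; rewrite ler0n.
have pDD := psd_sqr sD.
have h1 : \sum_(j < q) \tr (M ^+ j * D * M ^+ (q.-1 - j) * D)
    <= \tr (M ^+ q * (D * D)).
  case: q pN {pE} => [|q] pN.
    by rewrite big_ord0 psd_trace_mul//; exact: psdX.
  apply: (@le_trans _ _ (\sum_(j < q.+1) \tr (M ^+ q * (D * D)))).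
    apply: ler_sum => j _; apply: le_trans (trace_powers_le _ _ pM sD) _.
    by rewrite subnKC// -ltnS.
  rewrite sumr_const card_ord -subr_ge0.
  (* Now q + 1 stands for the original q; psd-ness of [(M - (q+1)) M^q] gives
     [(q+1) tr (M^q D^2) <= tr (M^(q+1) D^2)]. *)
  have := psd_trace_mul (psd_mul_pow_shift 1 q (ler0n _ _) pN) pDD.
  rewrite expr1 mulmxE !mulrBl !linearB /= -[_%:M * _ * _]mulrA -mulmxE.
  by rewrite mul_scalar_mx !mulmxE linearZ /= -exprS mulr_natl.
have h2 := psd_trace_mul (psdX q pM) pE.
rewrite mulmxE mulrN mulrDr linearN linearD /= in h2.
by lra.
Qed.

(** * Entrywise derivatives of matrix curves *)

Lemma derivable_pt_lim_sum (I : Type) (r : seq I) (P : pred I) (f : I -> R -> R) d t :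
  (forall i, P i -> derivable_pt_lim (f i) t (d i)) ->
  derivable_pt_lim (fun s => \sum_(i <- r | P i) f i s) t (\sum_(i <- r | P i) d i).
Proof.
move=> h; elim: r => [|i r IH].
  rewrite big_nil; have -> : (fun s : R => \sum_(i <- [::] | P i) f i s) = fct_cte 0.
    by apply: functional_extensionality => s; rewrite big_nil.
  exact: derivable_pt_lim_const.
rewrite big_cons; have -> : (fun s => \sum_(j <- i :: r | P j) f j s) =
    (fun s => if P i then f i s + \sum_(j <- r | P j) f j s
              else \sum_(j <- r | P j) f j s).
  by apply: functional_extensionality => s; rewrite big_cons.
by case: ifP => // Pi; apply: derivable_pt_lim_plus => //; exact: h.
Qed.

Definition mx_deriv m n (F : R -> 'M[R]_(m, n)) (t : R) (D : 'M[R]_(m, n)) : Prop :=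
  forall i j, derivable_pt_lim (fun s => F s i j) t (D i j).

Lemma mx_deriv_const m n (A : 'M[R]_(m, n)) t : mx_deriv (fun=> A) t 0.
Proof. by move=> i j; rewrite mxE; exact: derivable_pt_lim_const. Qed.

Lemma mx_derivD m n (F G : R -> 'M[R]_(m, n)) t D E :
  mx_deriv F t D -> mx_deriv G t E -> mx_deriv (fun s => F s + G s) t (D + E).
Proof.
move=> hF hG i j; rewrite mxE.
have -> : (fun s => (F s + G s) i j) = (fun s => F s i j + G s i j).
  by apply: functional_extensionality => s; rewrite mxE.
exact: derivable_pt_lim_plus.
Qed.

Lemma mx_deriv_scale m n (f : R -> R) (A : 'M[R]_(m, n)) t d :
  derivable_pt_lim f t d -> mx_deriv (fun s => f s *: A) t (d *: A).
Proof.
move=> hf i j; rewrite mxE.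
have -> : (fun s => (f s *: A) i j) = (fun s => f s * A i j).
  by apply: functional_extensionality => s; rewrite mxE.
have := derivable_pt_lim_mult f (fct_cte (A i j)) t d 0 hf
  (derivable_pt_lim_const _ _).
by rewrite /fct_cte Rmult_0_r Rplus_0_r.
Qed.

Lemma mx_derivM m n p (F : R -> 'M[R]_(m, n)) (G : R -> 'M[R]_(n, p)) t D E :
  mx_deriv F t D -> mx_deriv G t E ->
  mx_deriv (fun s => F s *m G s) t (D *m G t + F t *m E).
Proof.
move=> hF hG i j; rewrite !mxE -big_split /=.
have -> : (fun s => (F s *m G s) i j) = (fun s => \sum_k F s i k * G s k j).
  by apply: functional_extensionality => s; rewrite mxE.
apply: derivable_pt_lim_sum => k _; exact: derivable_pt_lim_mult.
Qed.

Lemma mx_derivX n (F : R -> 'M[R]_n) t D k : mx_deriv F t D ->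
  mx_deriv (fun s => F s ^+ k) t (\sum_(j < k) F t ^+ j * D * F t ^+ (k.-1 - j)).
Proof.
move=> hF; elim: k => [|k IH]; first by rewrite big_ord0; exact: mx_deriv_const.
have -> : (fun s => F s ^+ k.+1) = (fun s => F s ^+ k *m F s).
  by apply: functional_extensionality => s; rewrite exprSr.
have := mx_derivM IH hF; congr mx_deriv.
rewrite big_ord_recr /= subnn expr0 mulr1; congr (_ + _).
rewrite mulmxE mulr_suml; apply: eq_bigr => i _.
rewrite -mulrA -exprSr; congr (_ * _ ^+ _).
exact: ord_pred_subS.
Qed.

Lemma trace_deriv n (F : R -> 'M[R]_n) t D :
  mx_deriv F t D -> derivable_pt_lim (fun s => \tr (F s)) t (\tr D).
Proof. by move=> hF; apply: derivable_pt_lim_sum => i _; exact: hF. Qed.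

(** Under the trace, cyclicity makes all terms of the noncommutative power rule equal. *)
Lemma trace_power_deriv n (F : R -> 'M[R]_n) t D k : mx_deriv F t D ->
  derivable_pt_lim (fun s => \tr (F s ^+ k.+1)) t (k.+1%:R * \tr (F t ^+ k * D)).
Proof.
move=> hF; have := trace_deriv (mx_derivX k.+1 hF); congr derivable_pt_lim.
rewrite linear_sum /= (eq_bigr (fun=> \tr (F t ^+ k * D))); last first.
  move=> j _; rewrite -mulmxE mxtrace_mulC mulmxE mulrA -exprD subnK//.
  by rewrite -ltnS.
by rewrite sumr_const card_ord mulr_natl.
Qed.

(* The trace of the power is concave on [[l, u]], so it is minimal at an end point. *)
Lemma trace_power_endpoint n q (M M1 M2 : R -> 'M[R]_n) (l u : R) :
  l < 0 -> 0 < u ->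
  (forall t : R, l <= t <= u -> mx_deriv M t (M1 t)) ->
  (forall t : R, l <= t <= u -> mx_deriv M1 t (M2 t)) ->
  (forall t : R, l <= t <= u -> psd (M t - q%:R%:M)) ->
  (forall t, (M1 t)^T = M1 t) ->
  (forall t : R, l <= t <= u -> psd (- (M2 t + M1 t * M1 t))) ->
  \tr (M l ^+ q.+1) <= \tr (M 0 ^+ q.+1) \/ \tr (M u ^+ q.+1) <= \tr (M 0 ^+ q.+1).
Proof.
move=> l0 u0 dM dM1 pM sM1 pM2.
pose f s := \tr (M s ^+ q.+1); pose g s := \tr (M s ^+ q * M1 s).
have df t : l <= t <= u -> derivable_pt_lim f t (q.+1%:R * g t).
  by move=> /dM; exact: trace_power_deriv.
have dg t : l <= t <= u -> derivable_pt_lim g t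
    (\sum_(j < q) \tr (M t ^+ j * M1 t * M t ^+ (q.-1 - j) * M1 t)
     + \tr (M t ^+ q * M2 t)).
  move=> ht; have := trace_deriv (mx_derivM (mx_derivX q (dM t ht)) (dM1 t ht)).
  by rewrite linearD /= mulmxE mulr_suml linear_sum.
have mvt (h h' : R -> R) a b : l <= a -> a < b -> b <= u ->
    (forall t : R, l <= t <= u -> derivable_pt_lim h t (h' t)) ->
    exists c, [/\ h b - h a = h' c * (b - a), a < c & c < b].
  move=> la ab bu hh.
  have [c|c [e [/RltP ac /RltP cb]]] := MVT_cor2 h h' a b (elimT (RltP _ _) ab).
    move=> [/RleP ac /RleP cb]; apply: hh.
    by rewrite (le_trans la ac) (le_trans cb bu).
  by exists c.
(* Mean value points [c2 < 0 < c1] express the increments of [f] on the two sides through [g]. A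
   third one, for [g] between them, gives [g c1 <= g c2]; the sign of [g c1] then decides which end
   point is no higher than 0. *)
have [c1 [e1 c10 c1u]] := mvt _ _ _ _ (ltW l0) u0 (lexx _) df.
have [c2 [e2 lc2 c20]] := mvt _ _ _ _ (lexx _) l0 (ltW u0) df.
have [c3 [e3 c3l c3u]] := mvt _ _ _ _ (ltW lc2) (lt_trans c20 c10) (ltW c1u) dg.
have g12 : g c1 <= g c2.
  have ht : l <= c3 <= u.
    by rewrite (ltW (lt_trans lc2 c3l)) (ltW (lt_trans c3u c1u)).
  rewrite -subr_le0 e3 mulr_le0_ge0//; last by rewrite subr_ge0 ltW// (lt_trans c20).
  by apply: trace_power_hessian_le0; [exact: pM|exact: sM1|exact: pM2].
have [g1|g1] := lerP (g c1) 0.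
  right; rewrite -subr_le0 -/(f u) -/(f 0) e1 subr0.
  by rewrite mulr_le0_ge0 ?(ltW u0)// mulr_ge0_le0// ler0n.
left; rewrite -subr_ge0 -/(f l) -/(f 0) e2 sub0r.
by rewrite mulr_ge0 ?oppr_ge0 ?(ltW l0)// mulr_ge0 ?ler0n// (le_trans (ltW g1)).
Qed.

(** * The potential *)

Lemma RinvE (x : R) : x^-1 = Rinv x.
Proof.
rewrite /GRing.inv /= /R_inv; case: eqP => // ->.
by rewrite Rinv_0.
Qed.

(** Normalized by phi(0) = 0 and phi'(0) = g. It stays below [g x], while phi(1) is only logarithmic
    in g. *)
Definition phi (g x : R) : R := 2^-1 * ln (1 + 2 * g * x).
Definition dphi (g x : R) : R := g / (1 + 2 * g * x).

Lemma phi_arg_gt0 (g x : R) : 0 < g -> 0 <= x -> 0 < 1 + 2 * g * x.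
Proof. by move=> g0 x0; rewrite ltr_wpDr// mulr_ge0// mulr_ge0// ltW. Qed.

Lemma ln_le_subr1 (x : R) : 0 < x -> ln x <= x - 1.
Proof.
move=> x0; apply/RleP; have := exp_ineq1_le (ln x).
rewrite exp_ln; last exact/RltP.
by move=> /RleP h; apply/RleP; rewrite lerBrDl.
Qed.

Lemma ln_gt0 (x : R) : 1 < x -> 0 < ln x.
Proof.
move=> /RltP x1; apply/RltP; rewrite -[X in Rlt X _]ln_1.
by apply: ln_increasing x1; exact: Rlt_0_1.
Qed.

Lemma ln_ge0 (x : R) : 1 <= x -> 0 <= ln x.
Proof.
rewrite le_eqVlt => /orP[/eqP <-|/ln_gt0/ltW//].
by have -> : ln 1 = 0 by exact: ln_1.
Qed.

Lemma phi_ge0 (g x : R) : 0 < g -> 0 <= x -> 0 <= phi g x.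
Proof.
move=> g0 x0; apply: mulr_ge0; [by rewrite invr_ge0 ler0n|apply: ln_ge0].
by rewrite lerDl mulr_ge0// mulr_ge0 ?ler0n// ltW.
Qed.

Lemma phi_le (g x : R) : 0 < g -> 0 <= x -> phi g x <= g * x.
Proof.
move=> g0 x0; have := ln_le_subr1 (phi_arg_gt0 g0 x0).
by rewrite /phi => h; rewrite mulrC ler_pdivrMr//; lra.
Qed.

Lemma affine_deriv (a b t : R) : derivable_pt_lim (fun s => a + b * s) t b.
Proof.
have := derivable_pt_lim_plus _ _ t _ _ (derivable_pt_lim_const a t)
  (derivable_pt_lim_scal _ b t _ (derivable_pt_lim_id t)).
by rewrite Rplus_0_l Rmult_1_r.
Qed.

Lemma phi_deriv (g x e t : R) : 0 < g -> 0 <= x + e * t ->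
  derivable_pt_lim (fun s => phi g (x + e * s)) t (e * dphi g (x + e * t)).
Proof.
move=> g0 xt; have h0 := phi_arg_gt0 g0 xt.
have E s : 1 + 2 * g * (x + e * s) = (1 + 2 * g * x) + (2 * g * e) * s by ring.
have h : derivable_pt_lim ln ((1 + 2 * g * x) + (2 * g * e) * t)
    (Rinv ((1 + 2 * g * x) + (2 * g * e) * t)).
  by apply: derivable_pt_lim_ln; apply/RltP; rewrite -E.
have := derivable_pt_lim_scal _ (2^-1) _ _ (derivable_pt_lim_comp _ ln t _ _
  (affine_deriv (1 + 2 * g * x) (2 * g * e) t) h).
congr derivable_pt_lim.
  by apply: functional_extensionality => s; rewrite /phi E.
rewrite -RinvE -E /dphi.
change (2^-1 * ((1 + 2 * g * (x + e * t))^-1 * (2 * g * e)) = e * (g / (1 + 2 * g * (x + e * t)))).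
by field; rewrite gt_eqF.
Qed.

(** This is phi'' = - 2 phi'^2 along an affine path; [e] appears once because [dphi] carries no
    chain-rule factor. *)
Lemma dphi_deriv (g x e t : R) : 0 < g -> 0 <= x + e * t ->
  derivable_pt_lim (fun s => dphi g (x + e * s)) t (- (2 * e * dphi g (x + e * t) ^+ 2)).
Proof.
move=> g0 xt; have h0 := phi_arg_gt0 g0 xt.
have E s : 1 + 2 * g * (x + e * s) = (1 + 2 * g * x) + (2 * g * e) * s by ring.
have h : ((1 + 2 * g * x) + (2 * g * e) * t) <> 0 :> R.
  by apply/eqP; rewrite -E gt_eqF.
have := derivable_pt_lim_div (fct_cte g) _ _ _ _ (derivable_pt_lim_const _ _)
  (affine_deriv (1 + 2 * g * x) (2 * g * e) t) h.
congr derivable_pt_lim.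
  by apply: functional_extensionality => s; rewrite /dphi E RinvE.
rewrite /fct_cte /Rdiv -RinvE /Rsqr -E /dphi.
change ((0 * (1 + 2 * g * (x + e * t)) - 2 * g * e * g) *
  ((1 + 2 * g * (x + e * t)) * (1 + 2 * g * (x + e * t)))^-1 =
  - (2 * e * (g / (1 + 2 * g * (x + e * t))) ^+ 2)).
by field; rewrite gt_eqF.
Qed.

(** For psd [A t] and nonnegative [x], the shift by q puts the matrix above q, as
    [trace_power_hessian_le0] requires for the power q + 1. *)
Definition potential (T : finType) n (A : T -> 'M[R]_n) (g : R) (q : nat) (x : T -> R) : R :=
  \tr ((q%:R%:M + \sum_t phi g (x t) *: A t) ^+ q.+1).

Lemma eq_potential (T : finType) n (A : T -> 'M[R]_n) g q x y :
  x =1 y -> potential A g q x = potential A g q y.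
Proof. by move=> /functional_extensionality ->. Qed.

Lemma potential_swap (T : finType) n (A : T -> 'M[R]_n) (g : R) q
    (x : T -> R) a b (al be : R) :
  (forall t, psd (A t)) -> (forall t, \tr (A t) = 1) -> 0 < g ->
  (forall t, 0 <= x t) -> a != b ->
  0 < al -> al <= x a -> 0 < be -> be <= x b ->
  let y (d : R) := fun t => x t + d * ((t == b)%:R - (t == a)%:R) in
  potential A g q (y (- be)) <= potential A g q x \/
  potential A g q (y al) <= potential A g q x.
Proof.
move=> pA tA g0 x0 ab al0 ala be0 beb y.
(* [N] is constant along the exchange line; only the terms at [a] and [b] move. On [- be, al] both
   of their coordinates stay nonnegative. *)
pose N := q%:R%:M + \sum_(t | (t != b) && (t != a)) phi g (x t) *: A t.
pose M (d : R) := N + phi g (x b + 1 * d) *: A b + phi g (x a + (-1) * d) *: A a.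
pose M1 (d : R) := dphi g (x b + 1 * d) *: A b - dphi g (x a + (-1) * d) *: A a.
pose M2 (d : R) := - (2 * dphi g (x b + 1 * d) ^+ 2) *: A b
             + - (2 * dphi g (x a + (-1) * d) ^+ 2) *: A a.
have ME d : potential A g q (y d) = \tr (M d ^+ q.+1).
  rewrite /potential (bigD1 b)//= (bigD1 a)//= /M /N /y !eqxx (negbTE ab).
  rewrite [b == a]eq_sym (negbTE ab) subr0 sub0r mulr1 mul1r mulN1r mulrN1.
  congr (\tr (_ ^+ _)); rewrite -!addrA; congr (_ + _).
  rewrite [RHS]addrC -!addrA; congr (_ + (_ + _)).
  by apply: eq_bigr => t /andP[/negbTE -> /negbTE ->]; rewrite subr0 mulr0 addr0.
have xE : potential A g q x = \tr (M 0 ^+ q.+1).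
  by rewrite -ME; apply: eq_potential => t; rewrite /y mul0r addr0.
rewrite xE !ME; apply: (@trace_power_endpoint _ q M M1 M2) => //.
- by rewrite oppr_lt0.
- move=> d /andP[d1 d2].
  have hb : 0 <= x b + 1 * d by lra.
  have ha : 0 <= x a + (-1) * d by lra.
  have := mx_derivD (mx_derivD (mx_deriv_const N d)
    (mx_deriv_scale (A b) (phi_deriv g0 hb))) (mx_deriv_scale (A a) (phi_deriv g0 ha)).
  by congr mx_deriv; rewrite add0r /M1 !mul1r !mulN1r scaleNr.
- move=> d /andP[d1 d2].
  have e1 : derivable_pt_lim (fun s => - dphi g (x a + (-1) * s)) d
     (- (2 * dphi g (x a + (-1) * d) ^+ 2)).
    have h : 0 <= x a + (-1) * d by lra.
    have := derivable_pt_lim_opp _ _ _ (dphi_deriv g0 h).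
    congr derivable_pt_lim.
    rewrite -[LHS]/(- (- (2 * -1 * dphi g (x a + (-1) * d) ^+ 2))); ring.
  have h : 0 <= x b + 1 * d by lra.
  have := mx_derivD (mx_deriv_scale (A b) (dphi_deriv g0 h)) (mx_deriv_scale (A a) e1).
  congr mx_deriv; last by rewrite /M2 mulr1.
  by apply: functional_extensionality => s; rewrite /M1 scaleNr.
- move=> d /andP[d1 d2]; rewrite /M /N addrC !addrA addNr add0r -addrA.
  by apply: psdD; [apply: psd_sum => t _|apply: psdD]; apply: psdZ => //;
    apply: phi_ge0 => //; lra.
- by move=> d; rewrite /M1 linearB !linearZ /= !psd_sym.
move=> d /andP[d1 d2].
rewrite /M2 /M1; set u := dphi _ _; set v := dphi _ _.
(* Trace one gives [A t <= 1], hence [A t ^ 2 <= A t]. *)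
have pAA t : psd (A t *m (1%:M - A t)).
  by apply: psd_mul_scalar_sub => //; rewrite -(tA t); exact: psd_scalar_sub.
(* The parallelogram identity for [u A_b] and [v A_a] trades the square of the difference for the
   square of the sum, so every summand is psd. *)
have -> : - (- (2 * u ^+ 2) *: A b + - (2 * v ^+ 2) *: A a +
    (u *: A b - v *: A a) * (u *: A b - v *: A a)) =
  (2 * u ^+ 2) *: (A b *m (1%:M - A b)) + (2 * v ^+ 2) *: (A a *m (1%:M - A a))
   + (u *: A b + v *: A a) *m (u *: A b + v *: A a).
  rewrite !mulmxBr !mulmx1 -mulmxE !mulmxDl !mulmxDr !mulNmx !mulmxN.
  rewrite -!scalemxAl -!scalemxAr.
  move: (A b *m A b) (A b *m A a) (A a *m A b) (A a *m A a) => bb bA Ab aa.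
  by apply/matrixP => i j; rewrite !mxE; ring.
have ge0 (w : R) : 0 <= 2 * w ^+ 2 by rewrite mulr_ge0 ?ler0n ?sqr_ge0.
apply: psdD; first by apply: psdD; apply: psdZ.
by apply: psd_sqr; rewrite linearD !linearZ /= !psd_sym.
Qed.

(** Pairing [M^k] with [mu - M] shows that each further power costs at most a factor mu. *)
Lemma trace_pow_le n (M : 'M[R]_n) mu k : 0 <= mu -> psd M -> psd (mu%:M - M) ->
  \tr (M ^+ k) <= n%:R * mu ^+ k.
Proof.
move=> mu0 pM pN; elim: k => [|k IH]; first by rewrite !expr0 mulr1 mxtrace1.
apply: (@le_trans _ _ (mu * \tr (M ^+ k))); last first.
  by rewrite exprS mulrCA ler_wpM2l.
have := psd_trace_mul (psdX k pM) pN.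
by rewrite mulmxBr mul_mx_scalar linearB linearZ /= subr_ge0 mulmxE -exprSr.
Qed.

(** Let a be the form of [M] at [w]. It suffices that [M^j (M - a)] has nonnegative form at [w]: for
    j = 0 the value is 0, and passing to j + 1 multiplies by a and adds the psd matrix
    [(M - a) M^j (M - a)]. *)
Lemma psd_jensen n (M : 'M[R]_n) (w : 'rV[R]_n) k : psd M -> bform 1%:M w w = 1 ->
  bform M w w ^+ k <= bform (M ^+ k) w w.
Proof.
move=> pM w1; set a := bform M w w; have a0 : 0 <= a by exact: psd_bform.
have sM := psd_sym pM.
have pos j : 0 <= bform (M ^+ j *m (M - a%:M)) w w.
  elim: j => [|j IH].
    rewrite expr0 mul1mx bformDm -scaleN1r -scalemx1 !bformZm w1 mulr1 mulN1r.
    by rewrite subrr.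
  have -> : M ^+ j.+1 *m (M - a%:M) =
     (M - a%:M) *m M ^+ j *m (M - a%:M)^T + a *: (M ^+ j *m (M - a%:M)).
    have -> : (M - a%:M)^T = M - a%:M by rewrite linearB /= sM tr_scalar_mx.
    rewrite -mul_scalar_mx mulmxA -mulmxDl; congr (_ *m _).
    by rewrite mulmxBl subrK exprS mulmxE.
  rewrite bformDm bformZm addr_ge0// ?mulr_ge0// psd_bform//.
  by apply: psd_congr; exact: psdX.
elim: k => [|k IH]; first by rewrite !expr0 w1.
apply: (@le_trans _ _ (a * bform (M ^+ k) w w)); first by rewrite exprS ler_wpM2l.
have := pos k; rewrite mulmxBr mul_mx_scalar bformDm -scaleN1r !bformZm mulN1r.
by rewrite subr_ge0 mulmxE -exprSr.
Qed.

Lemma potential_le (T : finType) n (A : T -> 'M[R]_n) (g : R) q (x : T -> R) :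
  (forall t, psd (A t)) -> 0 < g -> (forall t, 0 <= x t) ->
  \sum_t x t *: A t = 1%:M ->
  potential A g q x <= n%:R * (q%:R + g) ^+ q.+1.
Proof.
move=> pA g0 x0 xA; apply: trace_pow_le.
- by rewrite addr_ge0 ?ler0n// ltW.
- apply: psdD; first by apply: psd_scalar; rewrite ler0n.
  by apply: psd_sum => t _; apply: psdZ => //; exact: phi_ge0.
have -> : (q%:R + g)%:M - (q%:R%:M + \sum_t phi g (x t) *: A t) =
    \sum_t (g * x t - phi g (x t)) *: A t.
  rewrite raddfD /= opprD addrA [_ + g%:M]addrC addrK -[g%:M]scalemx1 -xA.
  rewrite scaler_sumr -sumrB; apply: eq_bigr => t _.
  by rewrite scalerA scalerBl.
by apply: psd_sum => t _; apply: psdZ => //; rewrite subr_ge0 phi_le.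
Qed.

Lemma potential_indicator (T : finType) n (A : T -> 'M[R]_n) (g : R) q (B : {set T}) :
  potential A g q (fun t => (t \in B)%:R) =
  \tr ((q%:R%:M + phi g 1 *: \sum_(t in B) A t) ^+ q.+1).
Proof.
rewrite /potential; congr (\tr ((_ + _) ^+ _)).
rewrite scaler_sumr [RHS]big_mkcond /=; apply: eq_bigr => t _; case: ifP => _ //.
have -> : phi g false%:R = 0; last by rewrite scale0r.
rewrite /phi !mulr0 addr0; have -> : ln 1 = 0 by exact: ln_1.
by rewrite mulr0.
Qed.

(** Jensen moves the power inside the form, and the trace dominates the form at a unit vector. *)
Lemma bform_le_potential (T : finType) n (A : T -> 'M[R]_n) (g : R) q (B : {set T}) w :
  (forall t, psd (A t)) -> 0 < g -> bform 1%:M w w = 1 ->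
  (q%:R + phi g 1 * bform (\sum_(t in B) A t) w w) ^+ q.+1
    <= potential A g q (fun t => (t \in B)%:R).
Proof.
move=> pA g0 w1; rewrite potential_indicator; set M := (_ + _ : 'M_n).
have pM : psd M.
  apply: psdD; first by apply: psd_scalar; rewrite ler0n.
  by apply: psdZ; [apply: phi_ge0 => //; exact: ler01|apply: psd_sum].
have -> : q%:R + phi g 1 * bform (\sum_(t in B) A t) w w = bform M w w.
  by rewrite bformDm bformZm -scalemx1 bformZm w1 mulr1.
apply: le_trans (psd_jensen q.+1 pM w1) _.
by apply: le_trans (bform_le_trace w (psdX _ pM)) _; rewrite w1 mulr1.
Qed.

(** * Swap rounding *)

(** The symmetric basis exchange property of matroids, abstracted to any family of sets. *)
Definition symmetric_exchange (T : finType) (base : {set T} -> Prop) : Prop :=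
  forall B1 B2 a, base B1 -> base B2 -> a \in B1 :\: B2 ->
  exists b, [/\ b \in B2 :\: B1, base (b |: B1 :\ a) & base (a |: B2 :\ b)].

(** The consequence of concavity along [e_b - e_a] that rounding uses: of any two admissible moves
    in opposite directions, one does not increase [F]. *)
Definition swap_decreasing (T : finType) (F : (T -> R) -> R) : Prop :=
  forall (x : T -> R) a b (al be : R), (forall t, 0 <= x t) -> a != b ->
  0 < al -> al <= x a -> 0 < be -> be <= x b ->
  let y (d : R) := fun t => x t + d * ((t == b)%:R - (t == a)%:R) in
  F (y (- be)) <= F x \/ F (y al) <= F x.

(** Induction on the size of [B1 :\: B2]: each exchange moves one base closer to the other without
    increasing [F]. The vector [r] carries the bases not being merged. *)
Lemma merge_bases (T : finType) (base : {set T} -> Prop) (F : (T -> R) -> R) :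
  (forall B1 B2, base B1 -> base B2 -> #|B1| = #|B2|) ->
  symmetric_exchange base -> swap_decreasing F ->
  forall (B1 B2 : {set T}) (r : T -> R) (p1 p2 : R), base B1 -> base B2 ->
  (forall t, 0 <= r t) -> 0 < p1 -> 0 < p2 ->
  exists2 B, base B &
    F (fun t => r t + (p1 + p2) * (t \in B)%:R) <=
    F (fun t => r t + p1 * (t \in B1)%:R + p2 * (t \in B2)%:R).
Proof.
move=> cardB exch swapF B1 B2 r p1 p2 b1 b2 r0 p10 p20.
have [k] := ubnP #|B1 :\: B2|; elim: k => // k IH in B1 B2 b1 b2 *.
rewrite ltnS => hk.
have [/eqP|[a aB]] := set_0Vmem (B1 :\: B2).
  rewrite setD_eq0 => s12.
  have -> : B1 = B2 by apply/eqP; rewrite eqEcard s12 (cardB _ _ b1 b2) /=.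
  exists B2 => //; rewrite le_eqVlt; apply/orP; left; apply/eqP; congr F.
  by apply: functional_extensionality => t; rewrite mulrDl addrA.
have [b [bB b1' b2']] := exch _ _ _ b1 b2 aB.
move: (aB) (bB); rewrite !inE => /andP[aB2 aB1] /andP[bB1 bB2].
have ab : a != b by apply: contraNneq aB2 => ->.
set x := fun t => _ + p2 * _.
have x0 t : 0 <= x t by rewrite !addr_ge0// mulr_ge0 ?ler0n// ltW.
have xa : p1 <= x a by rewrite /x aB1 (negbTE aB2) mulr1 mulr0 addr0 lerDr.
have xb : p2 <= x b by rewrite /x bB2 (negbTE bB1) mulr1 mulr0 addr0 lerDr.
(* The step lengths are the weights themselves: moving back by p2 replaces [b] by [a] in [B2],
   moving forward by p1 replaces [a] by [b] in [B1]. *)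
have [h|h] := swapF x a b p1 p2 x0 ab p10 xa p20 xb.
  have [|B hB le] := IH B1 (a |: B2 :\ b) b1 b2'.
    apply: leq_trans hk; rewrite [X in (_ < X)%N](cardsD1 a) aB add1n ltnS.
    apply: subset_leq_card; apply/subsetP => t; rewrite !inE.
    case: (t == a) => //=; case: eqP => [->|_] /=; first by rewrite (negbTE bB1) andbF.
    by [].
  exists B => //; apply: le_trans le _; apply: le_trans h.
  rewrite le_eqVlt; apply/orP; left; apply/eqP; congr F.
  apply: functional_extensionality => t; rewrite /x !inE.
  have [->|ta] := eqVneq t a.
    by rewrite (negbTE ab) (negbTE aB2) /=; ring.
  have [->|tb] := eqVneq t b; first by rewrite bB2 /=; ring.
  by rewrite /=; ring.
have [|B hB le] := IH (b |: B1 :\ a) B2 b1' b2.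
  apply: leq_trans hk; rewrite [X in (_ < X)%N](cardsD1 a) aB add1n ltnS.
  apply: subset_leq_card; apply/subsetP => t; rewrite !inE.
  have [->|tb] /= := eqVneq t b; first by rewrite bB2.
  by move=> /andP[-> /andP[-> ->]].
exists B => //; apply: le_trans le _; apply: le_trans h.
rewrite le_eqVlt; apply/orP; left; apply/eqP; congr F.
apply: functional_extensionality => t; rewrite /x !inE.
have [->|ta] := eqVneq t a.
  by rewrite (negbTE ab) aB1 /=; ring.
have [->|tb] := eqVneq t b; first by rewrite (negbTE bB1) /=; ring.
by rewrite /=; ring.
Qed.

Lemma swap_rounding (T : finType) (base : {set T} -> Prop) (F : (T -> R) -> R) :
  (forall B1 B2, base B1 -> base B2 -> #|B1| = #|B2|) ->
  symmetric_exchange base -> swap_decreasing F ->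
  forall (I : eqType) (s : seq I) (w : I -> R) (B : I -> {set T}), s != [::] ->
  (forall i, i \in s -> 0 < w i /\ base (B i)) ->
  exists2 B', base B' &
    F (fun t => (\sum_(i <- s) w i) * (t \in B')%:R) <=
    F (fun t => \sum_(i <- s) w i * (t \in B i)%:R).
Proof.
move=> cardB exch swapF I [|i0 s]// w B _ ws.
have [w0 b0] := ws i0 (mem_head _ _).
have {}ws i : i \in s -> 0 < w i /\ base (B i).
  by move=> si; apply: ws; rewrite inE si orbT.
suff [B' b' le] : exists2 B', base B' &
    F (fun t => (w i0 + \sum_(i <- s) w i) * (t \in B')%:R) <=
    F (fun t => w i0 * (t \in B i0)%:R + \sum_(i <- s) w i * (t \in B i)%:R).
  exists B' => //; rewrite big_cons; apply: le_trans le _.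
  rewrite le_eqVlt; apply/orP; left; apply/eqP; congr F.
  by apply: functional_extensionality => t; rewrite big_cons.
(* The head becomes an arbitrary base [B0] of accumulated weight [p], into which the remaining bases
   are merged in turn. *)
move: (w i0) (B i0) w0 b0 => {i0}p B0.
elim: s ws p B0 => [|i s IH] ws p B0 p0 b0.
  exists B0 => //; rewrite le_eqVlt; apply/orP; left; apply/eqP; congr F.
  by apply: functional_extensionality => t; rewrite !big_nil !addr0.
have [wi bi] := ws i (mem_head _ _).
have {}ws j : j \in s -> 0 < w j /\ base (B j).
  by move=> sj; apply: ws; rewrite inE sj orbT.
have r0 t : 0 <= \sum_(j <- s) w j * (t \in B j)%:R.
  by rewrite big_seq sumr_ge0// => j /ws[/ltW wj _]; rewrite mulr_ge0 ?ler0n.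
have [B1 b1 le1] := merge_bases cardB exch swapF b0 bi r0 p0 wi.
have [B2 b2 le2] := IH ws (p + w i) B1 (addr_gt0 p0 wi) b1.
exists B2 => //; rewrite big_cons addrA; apply: le_trans le2 _.
have -> : (fun t => (p + w i) * (t \in B1)%:R + \sum_(j <- s) w j * (t \in B j)%:R)
   = (fun t => \sum_(j <- s) w j * (t \in B j)%:R + (p + w i) * (t \in B1)%:R).
  by apply: functional_extensionality => t; rewrite addrC.
apply: le_trans le1 _.
rewrite le_eqVlt; apply/orP; left; apply/eqP; congr F.
by apply: functional_extensionality => t; rewrite big_cons [RHS]addrA [RHS]addrC addrA.
Qed.

(** * Bases of a vector configuration *)

Definition linear_base (T : finType) n (v : T -> 'rV[R]_n) (B : {set T}) : Prop :=
  #|B| = n /\ row_full (\sum_(t in B) <<v t>>)%MS.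

(** The span [U] of [B1 :\ a] misses [v a]. Expanding [v a] over [B2], some term lies outside [U];
    its index b can replace a in [B1], and its nonzero coefficient lets a replace b in [B2]. *)
Lemma linear_exchange (T : finType) n (v : T -> 'rV[R]_n) :
  symmetric_exchange (linear_base v).
Proof.
move=> B1 B2 a [c1 f1] [c2 f2]; rewrite !inE => /andP[aB2 aB1].
pose U := (\sum_(t in B1 :\ a) <<v t>>)%MS.
have rU : (\rank U < n)%N.
  have le (P : {set T}) : (\rank (\sum_(t in P) <<v t>>)%MS <= #|P|)%N.
    rewrite -sum1_card; elim/big_rec2: _ => [|t m A _ le]; first by rewrite mxrank0.
    apply: leq_trans (mxrank_adds_leqif _ _).1 _; rewrite leq_add//.
    by rewrite mxrank_gen rank_leq_row.
  by apply: leq_ltn_trans (le _) _; rewrite -c1 [X in (_ < X)%N](cardsD1 a) aB1.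
have aU : ~~ (v a <= U)%MS.
  apply: contraL rU => aU; rewrite -leqNgt.
  have : (\sum_(t in B1) <<v t>> <= U)%MS.
    apply/sumsmx_subP => t tB; rewrite genmxE.
    have [->//|ta] := eqVneq t a.
    by rewrite (submx_trans _ (sumsmx_sup t _ (submx_refl _))) ?genmxE// !inE ta.
  by move=> /mxrankS; move: f1; rewrite /row_full => /eqP ->.
have /sub_sumsmxP[u ua] : (v a <= \sum_(t in B2) <<v t>>)%MS by exact: submx_full.
have [b bB2 bU] : exists2 b, b \in B2 & ~~ (u b *m <<v b>>%MS <= U)%MS.
  apply/exists_inP; apply: contraNT aU; rewrite negb_exists_in => /forall_inP h.
  by rewrite ua; apply: summx_sub => t tB; have := h t tB; rewrite negbK.
have bU' : ~~ (v b <= U)%MS.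
  by apply: contra bU => bU; rewrite (submx_trans (submxMl _ _))// genmxE.
have bnB1 : b \notin B1 :\ a.
  apply: contra bU' => bB.
  by rewrite (submx_trans _ (sumsmx_sup b bB (submx_refl _)))// genmxE.
have ab : b != a by apply: contraNneq aB2 => <-.
have bB1 : b \notin B1 by move: bnB1; rewrite !inE ab.
exists b; split; first by rewrite !inE bB1.
- split; first by rewrite cardsU1 bnB1 -c1 [RHS](cardsD1 a) aB1.
  set W := (\sum_(t in _) _)%MS.
  have UW : (U <= W)%MS.
    apply/sumsmx_subP => t tB; apply: (sumsmx_sup t) => //.
    by rewrite inE tB orbT.
  have bW : (v b <= W)%MS.
    by rewrite (submx_trans _ (sumsmx_sup b _ (submx_refl _))) ?genmxE// !inE eqxx.
  have UWr : (\rank U < \rank W)%N.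
    have : (U < W)%MS.
      by rewrite ltmxE UW /=; apply: contra bU' => WU; exact: submx_trans bW WU.
    by rewrite ltmxErank => /andP[].
  rewrite /row_full eqn_leq rank_leq_col /=; apply: leq_trans UWr.
  move: f1; rewrite /row_full (big_setD1 a)//= => /eqP {1}<-.
  apply: leq_trans (mxrank_adds_leqif _ _).1 _; apply: (@leq_add _ _ 1) => //.
  by rewrite mxrank_gen rank_leq_row.
have aD : a \notin B2 :\ b by rewrite !inE (negbTE aB2) andbF.
split; first by rewrite cardsU1 aD -c2 [RHS](cardsD1 b) bB2.
set W := (\sum_(t in _) _)%MS.
have tW t : t \in a |: B2 :\ b -> (v t <= W)%MS.
  by move=> tB; rewrite (submx_trans _ (sumsmx_sup t tB (submx_refl _)))// genmxE.
have bW : (v b <= W)%MS.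
  have /sub_rVP[c uc] : (u b *m <<v b>>%MS <= v b)%MS.
    by rewrite (submx_trans (submxMl _ _))// genmxE.
  have c0 : c != 0 by apply: contraNneq bU => c0; rewrite uc c0 scale0r sub0mx.
  (* The expansion of [v a] is solved for [v b]. *)
  have -> : v b = c^-1 *: (v a - \sum_(t in B2 :\ b) u t *m <<v t>>%MS).
    by rewrite ua (big_setD1 b)//= addrK uc scalerA mulVf// scale1r.
  apply: scalemx_sub; apply: addmx_sub; first by apply: tW; rewrite !inE eqxx.
  rewrite eqmx_opp; apply: summx_sub => t tB.
  apply: submx_trans (submxMl _ _) _; rewrite genmxE; apply: tW.
  by rewrite inE tB orbT.
rewrite -sub1mx; apply: (@submx_trans _ _ _ _ _ _ (\sum_(t in B2) <<v t>>)%MS).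
  by rewrite sub1mx.
apply/sumsmx_subP => t tB; rewrite genmxE.
have [->//|tb] := eqVneq t b.
by apply: tW; rewrite !inE tb tB orbT.
Qed.

(** * Squared determinants as weights on tuples *)

Definition select_rows (T : finType) n (v : T -> 'rV[R]_n) (f : {ffun 'I_n -> T}) : 'M[R]_n :=
  \matrix_k v (f k).

(** A weighted Cauchy-Binet formula over ordered tuples: both determinants are expanded and the sum
    over [f] factors position by position. The weights [c] allow one position to be pinned. *)
Lemma sum_det_sqr (T : finType) n (v : T -> 'rV[R]_n) (c : 'I_n -> T -> R) :
  \sum_f \det (select_rows v f) ^+ 2 * \prod_k c k (f k) =
  \sum_(s : 'S_n) \sum_(s' : 'S_n) (-1) ^+ s * (-1) ^+ s' *
    \prod_k \sum_t c k t * (v t 0 (s k) * v t 0 (s' k)).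
Proof.
under [RHS]eq_bigr do under eq_bigr do rewrite bigA_distr_bigA mulr_sumr.
under [RHS]eq_bigr do rewrite exchange_big.
rewrite [RHS]exchange_big; apply: eq_bigr => f _.
rewrite expr2 /determinant mulr_suml mulr_suml; apply: eq_bigr => s _.
rewrite mulr_sumr mulr_suml; apply: eq_bigr => s' _.
have e (s0 : 'S_n) :
    \prod_k select_rows v f k (s0 k) = \prod_k v (f k) 0 (s0 k).
  by apply: eq_bigr => k _; rewrite mxE.
rewrite !e.
have -> : \prod_k (c k (f k) * (v (f k) 0 (s k) * v (f k) 0 (s' k))) =
    \prod_k c k (f k) * (\prod_k v (f k) 0 (s k) * \prod_k v (f k) 0 (s' k)).
  by rewrite -!big_split.
move: (\prod_k c k (f k)) (\prod_k v (f k) 0 (s k)) (\prod_k v (f k) 0 (s' k)).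
move: ((-1) ^+ s) ((-1) ^+ s') => x y X Y Z.
by rewrite [X * _]mulrC !mulrA [x * Y * y]mulrAC.
Qed.

Lemma parseval_entry (T : finType) n (v : T -> 'rV[R]_n) i j :
  \sum_t (v t)^T *m v t = 1%:M -> \sum_t v t 0 i * v t 0 j = (i == j)%:R.
Proof.
move=> /matrixP/(_ i j); rewrite summxE mxE => <-.
by apply: eq_bigr => t _; rewrite mxE big_ord1 mxE.
Qed.

(** The Parseval identity turns each factor into a Kronecker delta, so only the pairs [s = s']
    survive. *)
Lemma sum_det_sqr_total (T : finType) n (v : T -> 'rV[R]_n) :
  \sum_t (v t)^T *m v t = 1%:M ->
  \sum_f \det (select_rows v f) ^+ 2 = n`!%:R.
Proof.
move=> hv; transitivity (\sum_f \det (select_rows v f) ^+ 2 * \prod_(k < n) 1).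
  by apply: eq_bigr => f _; rewrite big1_eq mulr1.
rewrite (sum_det_sqr v (fun _ _ => 1)).
transitivity (\sum_(s : 'S_n) (1 : R)); last by rewrite sumr_const card_Sn.
apply: eq_bigr => s _; rewrite (bigD1 s)//= [X in _ + X]big1 ?addr0.
  rewrite -expr2 sqrr_sign mul1r big1// => k _.
  by under eq_bigr do rewrite mul1r; rewrite parseval_entry// eqxx.
move=> s' ss'; have [k ks] : exists k, s k != s' k.
  apply/existsP; apply: contraNT ss'; rewrite negb_exists => /forallP h.
  by apply/eqP/permP => k; have := h k; rewrite negbK => /eqP.
rewrite (bigD1 k)//=; under eq_bigr do rewrite mul1r.
by rewrite parseval_entry// (negbTE ks) mul0r mulr0.
Qed.

Lemma sum_det_sqr_marginal (T : finType) n (v : T -> 'rV[R]_n) t0 :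
  \sum_t (v t)^T *m v t = 1%:M ->
  \sum_f \det (select_rows v f) ^+ 2 * (\sum_k (f k == t0)%:R) =
  n`!%:R * bform 1%:M (v t0) (v t0).
Proof.
move=> hv.
(* Position [k0] is pinned to [t0]. The deltas at the other positions still force [s = s'], leaving
   a squared coordinate of [v t0]. *)
pose c (k0 k : 'I_n) (t : T) : R := if k == k0 then (t == t0)%:R else 1.
transitivity (\sum_(k0 < n) \sum_f \det (select_rows v f) ^+ 2 * \prod_k c k0 k (f k)).
  rewrite exchange_big /=; apply: eq_bigr => f _; rewrite mulr_sumr.
  apply: eq_bigr => k0 _; rewrite (bigD1 k0)//= /c eqxx big1 ?mulr1// => k /negbTE -> //.
transitivity (\sum_(k0 < n) \sum_(s : 'S_n) v t0 0 (s k0) ^+ 2).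
  apply: eq_bigr => k0 _; rewrite sum_det_sqr; apply: eq_bigr => s _.
  have prodE (s' : 'S_n) : \prod_k \sum_t c k0 k t * (v t 0 (s k) * v t 0 (s' k)) =
      v t0 0 (s k0) * v t0 0 (s' k0) * \prod_(k | k != k0) (s k == s' k)%:R.
    rewrite (bigD1 k0)//=; congr (_ * _).
      rewrite (bigD1 t0)//= /c !eqxx mul1r big1 ?addr0// => t /negbTE ->.
      by rewrite mul0r.
    apply: eq_bigr => k /negbTE kk; rewrite -(parseval_entry _ _ hv).
    by apply: eq_bigr => t _; rewrite /c kk mul1r.
  rewrite (bigD1 s)//= [X in _ + X]big1 ?addr0.
    rewrite prodE -expr2 sqrr_sign mul1r big1 ?mulr1 ?expr2// => k _.
    by rewrite eqxx.
  move=> s' ss'; have [k kk0 ks] : exists2 k, k != k0 & s k != s' k.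
    apply/exists_inP; apply: contraNT ss'; rewrite negb_exists_in => /forall_inP h.
    have {}h k : k != k0 -> s k = s' k by move=> /h; rewrite negbK => /eqP.
    (* Two permutations agreeing off one point are equal. *)
    apply/eqP/permP => k; have [->|kk0] := eqVneq k k0; last by rewrite h.
    have := permKV s (s' k0); set k1 := (s^-1)%g (s' k0) => e.
    have [k10|k10] := eqVneq k1 k0; first by rewrite -e k10.
    by have /eqP := e; rewrite (h _ k10) (inj_eq perm_inj) (negbTE k10).
  by rewrite prodE (bigD1 k)//= (negbTE ks) mul0r !mulr0.
rewrite exchange_big /= (eq_bigr (fun=> bform 1%:M (v t0) (v t0))).
  by rewrite sumr_const card_Sn mulr_natl.
move=> s _; rewrite /bform mulmx1 mxE [RHS](reindex_inj (@perm_inj _ s)) /=.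
by apply: eq_bigr => k _; rewrite mxE expr2.
Qed.

Lemma select_rows_inj (T : finType) n (v : T -> 'rV[R]_n) f :
  \det (select_rows v f) != 0 -> injective f.
Proof.
move=> d0 i j fij; apply/eqP; apply: contraNT d0 => ij; apply/eqP.
by apply: (determinant_alternate ij) => k; rewrite !mxE fij.
Qed.

Lemma select_rows_base (T : finType) n (v : T -> 'rV[R]_n) (f : {ffun 'I_n -> T}) :
  \det (select_rows v f) != 0 -> linear_base v [set f k | k in 'I_n].
Proof.
move=> d0; split; first by rewrite card_imset ?card_ord//; exact: select_rows_inj d0.
have u : row_full (select_rows v f).
  by rewrite row_full_unit unitmxE unitfE.
rewrite -sub1mx; apply: (@submx_trans _ _ _ _ _ _ (select_rows v f)).
  by rewrite sub1mx.
apply/row_subP => k; rewrite rowK.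
by rewrite (submx_trans _ (sumsmx_sup (f k) _ (submx_refl _))) ?genmxE ?imset_f.
Qed.

Lemma linear_rounding (T : finType) n (v : T -> 'rV[R]_n) (F : (T -> R) -> R) :
  \sum_t (v t)^T *m v t = 1%:M -> swap_decreasing F ->
  exists2 B, linear_base v B &
    F (fun t => (t \in B)%:R) <= F (fun t => bform 1%:M (v t) (v t)).
Proof.
move=> hv swapF.
pose d f := \det (select_rows v f).
(* Only tuples with nonzero determinant are kept: they have positive weight and their images are
   bases. *)
pose s := [seq f <- enum {ffun 'I_n -> T} | d f != 0].
pose w f := d f ^+ 2 / n`!%:R.
pose B (f : {ffun 'I_n -> T}) := [set f k | k in 'I_n].
have nf0 : n`!%:R != 0 :> R by rewrite pnatr_eq0 -lt0n fact_gt0.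
have sumE (h : {ffun 'I_n -> T} -> R) :
    \sum_(f <- s) w f * h f = (\sum_f d f ^+ 2 * h f) / n`!%:R.
  rewrite /s big_filter big_mkcond big_enum /= mulr_suml.
  apply: eq_bigr => f _; case: eqP => [->|_] /=; first by rewrite expr0n /= !mul0r.
  by rewrite /w mulrAC.
have w1 : \sum_(f <- s) w f = 1.
  transitivity (\sum_(f <- s) w f * 1); first by apply: eq_bigr => f _; rewrite mulr1.
  rewrite sumE; under eq_bigr do rewrite mulr1.
  by rewrite sum_det_sqr_total// divff.
have s0 : s != [::].
  by apply/eqP => s0; move/eqP: w1; rewrite s0 big_nil eq_sym oner_eq0.
have sB f : f \in s -> 0 < w f /\ linear_base v (B f).
  rewrite mem_filter => /andP[df _]; split; last exact: select_rows_base.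
  by rewrite /w divr_gt0// ?ltr0n ?fact_gt0// exprn_even_gt0.
have cardB B1 B2 : linear_base v B1 -> linear_base v B2 -> #|B1| = #|B2|.
  by move=> [-> _] [-> _].
have [B' b' le] := swap_rounding cardB (@linear_exchange _ _ v) swapF s0 sB.
exists B' => //; move: le; rewrite w1.
have -> : (fun t => 1 * (t \in B')%:R) = (fun t => (t \in B')%:R : R).
  by apply: functional_extensionality => t; rewrite mul1r.
(* For injective [f], the number of k with [f k = t] is the indicator of [B f], so the convex
   combination is the vector of squared norms by [sum_det_sqr_marginal]. *)
congr (_ <= F _); apply: functional_extensionality => t.
apply: (mulfI nf0); rewrite -sum_det_sqr_marginal// sumE mulrC mulfVK//.
apply: eq_bigr => f _; have [df|df] := eqVneq (d f) 0.
  by rewrite -/(d f) df expr0n /= !mul0r.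
congr (_ * _); have fI := select_rows_inj df.
have [/imsetP[k _ ->]|tB] := boolP (t \in B f).
  rewrite (bigD1 k)//= eqxx big1 ?addr0// => k' kk'.
  by rewrite (inj_eq fI) (negbTE kk').
rewrite big1// => k _; case: eqP => // fk.
by rewrite -fk imset_f in tB.
Qed.

(** * Assembling the bound *)

Lemma bform_sum (I : Type) (r : seq I) (P : pred I) n (A : I -> 'M[R]_n) u v :
  bform (\sum_(i <- r | P i) A i) u v = \sum_(i <- r | P i) bform (A i) u v.
Proof. by rewrite /bform mulmx_sumr mulmx_suml summxE. Qed.

Lemma bform_gram m n (W : 'M[R]_(m, n)) (z : 'rV[R]_n) :
  bform (W^T *m W) z z = bform 1%:M (z *m W^T) (z *m W^T).
Proof. by rewrite /bform mulmx1 trmx_mul trmxK !mulmxA. Qed.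

Lemma bform1_eq0 n (z : 'rV[R]_n) : bform 1%:M z z = 0 -> z = 0.
Proof.
rewrite /bform mulmx1 mxE => /eqP; rewrite psumr_eq0; last first.
  by move=> j _; rewrite mxE -expr2 sqr_ge0.
move=> /allP h; apply/rowP => j; have := h j (mem_index_enum _).
by rewrite !mxE -expr2 expf_eq0 /= => /eqP.
Qed.

Lemma eigenvalue_bform n (A : 'M[R]_n) a : eigenvalue A a ->
  exists2 w : 'rV[R]_n, bform 1%:M w w = 1 & bform A w w = a.
Proof.
move=> /eigenvalueP[v vA v0].
have b0 : 0 < bform 1%:M v v.
  rewrite lt_def psd_bform ?andbT; last exact: psd1.
  by apply: contra_neq v0; exact: bform1_eq0.
set b := bform 1%:M v v in b0.
have sq : sqrt b * sqrt b = b by apply: sqrt_sqrt; apply/RleP; exact: ltW.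
have bA : bform A v v = a * b by rewrite /b -bformZl /bform vA mulmx1.
have nb : (sqrt b)^-1 * ((sqrt b)^-1 * b) = 1.
  by rewrite mulrA -invfM sq mulVf// gt_eqF.
exists ((sqrt b)^-1 *: v); rewrite bformZl bformZr// bA.
by rewrite [a * b]mulrC !mulrA -[_ * _ * b]mulrA nb mul1r.
Qed.

Lemma sum_gram_rows m n (W : 'M[R]_(m, n)) : \sum_j (row j W)^T *m row j W = W^T *m W.
Proof.
apply/matrixP => i k; rewrite summxE mxE; apply: eq_bigr => j _.
by rewrite mxE big_ord1 !mxE.
Qed.

(** [S] is the set of blocks met by the rounded basis of rows. The number [b] is a value of the form
    that counts a block once per basis row in it, whereas [Y] counts it once. *)
Lemma normalized_sparsifier n m (X : 'I_m -> 'M[R]_n) (g : R) (q : nat) : 0 < g ->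
  (forall i, X i != 0) -> (forall i, psd (X i)) -> \sum_(i < m) X i = 1%:M ->
  exists S : {set 'I_m}, (#|S| <= n)%N /\
  let Y := \sum_(i in S) (\tr (X i))^-1 *: X i in
  \rank Y = n /\ forall a : R, eigenvalue Y a ->
    exists b : R, [/\ a <= b, 0 <= b &
      (q%:R + phi g 1 * b) ^+ q.+1 <= n%:R * (q%:R + g) ^+ q.+1].
Proof.
move=> g0 X0 pX X1.
have [W XW] := fin_all_exists (fun i => psd_gramP (pX i)).
have trX i : 0 < \tr (X i) by exact: psd_trace_gt0.
pose N i := (\tr (X i))^-1 *: X i.
have pN i : psd (N i) by apply: psdZ => //; rewrite invr_ge0 ltW.
pose T := ('I_m * 'I_n)%type.
pose v (t : T) := row t.2 (W t.1).
pose A (t : T) := N t.1.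
have pA t : psd (A t) by exact: pN.
have tA t : \tr (A t) = 1 by rewrite linearZ /= mulVf// gt_eqF.
have vv : \sum_t (v t)^T *m v t = 1%:M.
  rewrite -X1 -(pair_bigA _ (fun i j => (row j (W i))^T *m row j (W i))) /=.
  by apply: eq_bigr => i _; rewrite sum_gram_rows XW.
pose x (t : T) := bform 1%:M (v t) (v t).
have x0 t : 0 <= x t by apply: psd_bform; exact: psd1.
have xA : \sum_t x t *: A t = 1%:M.
  rewrite -X1 -(pair_bigA _ (fun i j => bform 1%:M (row j (W i)) (row j (W i)) *: N i)) /=.
  (* The squared norms of the rows in block i add up to [tr X_i], cancelling the normalization. *)
  apply: eq_bigr => i _; rewrite -scaler_suml -trace_mul_gram mul1mx -XW /N.
  by rewrite scalerA divff ?scale1r// gt_eqF.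
have swapF : swap_decreasing (potential A g q).
  by move=> y a b al be y0 ab al0 ala be0 beb /=; exact: potential_swap.
have [B [cB fB] leB] := linear_rounding vv swapF.
have {}leB := le_trans leB (potential_le q pA g0 x0 xA).
exists [set t.1 | t in B]; split; first by rewrite -[X in (_ <= X)%N]cB leq_imset_card.
set S := [set _ | _ in _]; move=> Y.
have pY : psd Y by apply: psd_sum => i _; exact: pN.
split.
  apply/eqP; apply: inj_row_free => z zY.
  (* A vector in the kernel of [Y] is orthogonal to all rows of the chosen blocks, in particular to
     a basis. *)
  have bz i : i \in S -> W i *m z^T = 0.
    move=> iS; have : bform Y z z = 0 by rewrite /bform zY mul0mx mxE.
    move/eqP; rewrite bform_sum psumr_eq0; last by move=> j _; exact: psd_bform (pN j).
    move=> /allP/(_ i (mem_index_enum _)); rewrite iS /= bformZm mulf_eq0 invr_eq0.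
    rewrite gt_eqF//= XW bform_gram => /eqP/bform1_eq0 e.
    by rewrite -[LHS]trmxK trmx_mul trmxK e trmx0.
  have : ((1%:M : 'M[R]_n) <= kermx z^T)%MS.
    apply: (@submx_trans _ _ _ _ _ _ (\sum_(t in B) <<v t>>)%MS); first by rewrite sub1mx.
    apply/sumsmx_subP => t tB; rewrite genmxE; apply/sub_kermxP.
    by rewrite -row_mul bz ?row0//; exact: imset_f.
  by move/sub_kermxP; rewrite mul1mx => e; rewrite -[z]trmxK e trmx0.
move=> a /eigenvalue_bform[w w1 <-].
exists (bform (\sum_(t in B) A t) w w); split.
- rewrite !bform_sum [leRHS](partition_big (fun t : T => t.1) (mem S)) /=; last first.
    by move=> t tB; exact: imset_f.
  apply: ler_sum => _ /imsetP[t tB ->].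
  rewrite (bigD1 t) ?tB ?eqxx//= lerDl sumr_ge0// => t' _; exact: psd_bform (pA t').
- by rewrite bform_sum sumr_ge0// => t _; exact: psd_bform (pA t).
by apply: le_trans leB; exact: bform_le_potential.
Qed.

(** * Estimates for the logarithm *)

Lemma INR_natr n : INR n = n%:R.
Proof. by elim: n => // n IH; rewrite S_INR IH -natr1. Qed.

Lemma lnM (x y : R) : 0 < x -> 0 < y -> ln (x * y) = ln x + ln y.
Proof. by move=> /RltP x0 /RltP y0; exact: ln_mult. Qed.

Lemma ln_exprn (x : R) k : 0 < x -> ln (x ^+ k) = k%:R * ln x.
Proof.
move=> x0; elim: k => [|k IH]; first by rewrite expr0 mul0r; exact: ln_1.
by rewrite exprS lnM ?exprn_gt0// IH -nat1r mulrDl mul1r.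
Qed.

Lemma ler_ln (x y : R) : 0 < x -> x <= y -> ln x <= ln y.
Proof.
move=> x0; rewrite le_eqVlt => /orP[/eqP-> //|xy].
by apply/ltW/RltP; apply: ln_increasing; exact/RltP.
Qed.

(** From [ln x <= x - 1] at 5/6 follows [ln (6/5) >= 1/6], and (6/5)^6 < 3. *)
Lemma ln3_gt1 : 1 < ln (3 : R).
Proof.
have i0 : 0 < (5 / 6 : R) by rewrite divr_gt0 ?ltr0n.
have h : ln (5 / 6 : R) <= - (1 / 6).
  apply: le_trans (ln_le_subr1 i0) _; rewrite le_eqVlt; apply/orP; left; apply/eqP.
  by field.
have e : 0 = 6%:R * ln (5 / 6 : R) + 6%:R * ln (6 / 5 : R).
  rewrite -mulrDr -lnM ?divr_gt0 ?ltr0n//.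
  have -> : (5 / 6) * (6 / 5) = 1 :> R by field.
  by have -> : ln 1 = 0 by [exact: ln_1]; rewrite mulr0.
have l : 6%:R * ln (6 / 5 : R) < ln (3 : R).
  rewrite -ln_exprn ?divr_gt0 ?ltr0n//; apply/RltP; apply: ln_increasing; apply/RltP.
    by rewrite exprn_gt0// divr_gt0 ?ltr0n.
  rewrite expr_div_n ltr_pdivrMr ?exprn_gt0 ?ltr0n//.
  by rewrite -!natrX -natrM ltr_nat.
have h' : 6%:R * ln (5 / 6 : R) <= -1.
  apply: le_trans (_ : 6%:R * - (1 / 6) <= _); first by rewrite ler_wpM2l ?ler0n.
  by rewrite le_eqVlt; apply/orP; left; apply/eqP; field.
by lra.
Qed.

Theorem theoremC1 :
  exists c : R, 0 < c /\
  forall (n m : nat), (3 <= n)%N ->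
  forall X : 'I_m -> 'M[R]_n,
    (forall i, X i != 0) ->
    (forall i, psd (X i)) ->
    \sum_(i < m) X i = 1%:M ->
    exists S : {set 'I_m},
      (#|S| <= n)%N /\
      let Y := \sum_(i in S) (\tr (X i))^-1 *: X i in
      \rank Y = n /\
      (forall a : R, eigenvalue Y a ->
         a <= c * ln (INR n) / ln (ln (INR n))).
Proof.
(* With [q <= L] and [g <= L / 2] one has [3 (q + g) <= 9 L / 2]; the factor 1/2 in [phi] doubles
   this to 9 L. *)
exists 9%:R; split; first by rewrite ltr0n.
move=> n m n3 X X0 pX X1; rewrite INR_natr.
set L := ln n%:R.
have L1 : 1 < L.
  apply: lt_le_trans ln3_gt1 _; apply: ler_ln; first by rewrite ltr0n.
  by rewrite ler_nat.
have lL0 := ln_gt0 L1.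
pose g := (L - 1) / 2.
have g0 : 0 < g by rewrite divr_gt0 ?ltr0n// subr_gt0.
have g2 : 1 + 2 * g * 1 = L by rewrite /g mulr1 mulrC divfK ?pnatr_eq0// addrC subrK.
pose q := trunc_log 3 n.
have [S [cS [rY eY]]] := normalized_sparsifier q g0 X0 pX X1.
exists S; split=> //; split=> // a /eY[b [ab b0 hb]].
apply: le_trans ab _.
have n0 : (0 < n)%N by exact: leq_trans n3.
have qL : q%:R <= L.
  apply: (@le_trans _ _ (q%:R * ln 3)).
    by rewrite ler_peMr ?ler0n// ltW// ln3_gt1.
  rewrite -ln_exprn ?ltr0n//; apply: ler_ln; first by rewrite exprn_gt0 ?ltr0n.
  by rewrite -natrX ler_nat; exact: trunc_logP.
have n3q : n%:R <= 3%:R ^+ q.+1 :> R.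
  by rewrite -natrX ler_nat ltnW//; exact: trunc_log_ltn.
have qg : 0 <= q%:R + g by rewrite addr_ge0 ?ler0n// ltW.
have ph : phi g 1 = 2^-1 * ln L by rewrite /phi g2.
(* The (q+1)-st root is taken, with n bounded by 3^(q+1). *)
have : q%:R + phi g 1 * b <= 3 * (q%:R + g).
  rewrite -(@ler_pXn2r _ q.+1)// ?nnegrE.
  - by apply: le_trans hb _; rewrite exprMn ler_wpM2r// exprn_ge0.
  - by rewrite addr_ge0 ?ler0n// mulr_ge0// phi_ge0// ler01.
  - by rewrite mulr_ge0 ?ler0n.
rewrite ler_pdivlMr// ph => h.
have q0 : 0 <= q%:R :> R by rewrite ler0n.
have e : 2 * (2^-1 * ln L * b) = b * ln L by field.
have e2 : 2 * g = L - 1 by rewrite /g mulrC divfK// pnatr_eq0.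
move: h e e2; set y := 2^-1 * _ * b => h e e2.
rewrite -e; lra.
Qed.
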